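(* Let $n\ge 1$, $d\ge 2$ and $1\le k\le n$ be integers, and let $R=n-k\lfloor n/k\rfloor$. For every $k$-separable state $\rho$ on $(\mathbb{C}^d)^{\otimes n}$, the full-body correlation tensor satisfies $$\|\tau(\rho)\|\le \sqrt{(d^2-1)^{k}\,\big(d^{\lceil n/k\rceil-2}\big)^{R}\,\big(d^{\lfloor n/k\rfloor-2}\big)^{k-R}}.$$
   Context: Consider $n$ qudits with Hilbert space $(\mathbb{C}^d)^{\otimes n}$. Let $\lambda_0=\mathbb{1}_d$ and let $\lambda_1,\dots,\lambda_{d^2-1}$ be Hermitian traceless $d\times d$ matrices (generators of $SU(d)$) normalized so that $\mathrm{Tr}[\lambda_i\lambda_j]=d\,\delta_{ij}$ for all $i,j\in\{0,\dots,d^2-1\}$. For a nonempty subset $\alpha\subseteq\{1,\dots,n\}$ and a state $\rho$, let $\rho_\alpha$ be the reduced state on the parties in $\alpha$ and define $\|\tau_\alpha(\rho)\|^2=\sum_{(i_k)_{k\in\alpha}\in\{1,\dots,d^2-1\}^{\alpha}}\big(\mathrm{Tr}[\rho_\alpha\bigotimes_{k\in\alpha}\lambda_{i_k}]\big)^2$. The full-body correlation tensor norm is $\|\tau(\rho)\|:=\|\tau_{\{1,\dots,n\}}(\rho)\|$. A pure state is $k$-separable if it is a tensor product of $k$ pure states on the $k$ blocks of some partition of $\{1,\dots,n\}$ into $k$ nonempty blocks; a (mixed) state is $k$-separable if it is a convex combination of $k$-separable pure states (the partitions may differ between terms). *)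

(* Defs.v *)
(* R : realType, complex numbers C := R[i] (mathcomp-real-closed). *)
From HB Require Import structures.
From mathcomp Require Import all_boot all_order all_algebra.
From mathcomp Require Import complex.
From mathcomp Require Import reals.
Set Implicit Arguments. Unset Strict Implicit. Unset Printing Implicit Defensive.
Import Order.TTheory GRing.Theory Num.Theory.
Local Open Scope ring_scope.
Local Open Scope complex_scope.

(* Computational basis of (C^d)^{\otimes n}: x : 'I_n -> 'I_d. *)
Definition qidx (n d : nat) := {ffun 'I_n -> 'I_d}.

(* An operator on (C^d)^{\otimes n}, given by its matrix entries <x|A|y>. *)
Definition qop (R : realType) (n d : nat) := qidx n d -> qidx n d -> R[i].

(* f depends only on the coordinates in S (i.e. is a vector on the parties in S). *)
Definition depends_only_on (R : realType) (n d : nat) (S : pred 'I_n)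
    (f : qidx n d -> R[i]) : Prop :=
  forall x y : qidx n d, (forall j, S j -> x j = y j) -> f x = f y.

(* psi is a normalized k-separable pure state: psi = (x) of k vectors on the k
   (nonempty) blocks blk^-1(b), b : 'I_k, of a partition of {1..n}. *)
Definition kseparable_pure (R : realType) (n d k : nat) (psi : qidx n d -> R[i]) : Prop :=
  (\sum_x `|psi x| ^+ 2 = 1) /\
  exists blk : 'I_n -> 'I_k,
    (forall b : 'I_k, exists j, blk j = b) /\
    exists phi : 'I_k -> qidx n d -> R[i],
      (forall b, depends_only_on [pred j | blk j == b] (phi b)) /\
      (forall x, psi x = \prod_(b < k) phi b x).

(* rho is a (finite) convex combination of projectors onto k-separable pure states. *)
Definition kseparable (R : realType) (n d k : nat) (rho : qop R n d) : Prop :=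
  exists (m : nat) (p : 'I_m -> R) (psi : 'I_m -> qidx n d -> R[i]),
    (forall l, 0 <= p l) /\ (\sum_l p l = 1) /\
    (forall l, kseparable_pure k (psi l)) /\
    (forall x y, rho x y = \sum_l (p l)%:C * psi l x * (psi l y)^*).

(* Generators lambda_1..lambda_{d^2-1} (index l : 'I_(d^2-1) stands for l+1):
   Hermitian, traceless, Tr[lambda_i lambda_j] = d delta_ij.  (lambda_0 = 1.) *)
Definition su_generators (R : realType) (d : nat) (lam : 'I_(d ^ 2 - 1) -> 'M[R[i]]_d) : Prop :=
  (forall l a b, lam l a b = (lam l b a)^*) /\
  (forall l, \tr (lam l) = 0) /\
  (forall l l', \tr (lam l *m lam l') = (d%:R) * (l == l')%:R).

(* Tr[rho (lambda_{i_1} (x) ... (x) lambda_{i_n})] *)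
Definition corr (R : realType) (n d : nat) (lam : 'I_(d ^ 2 - 1) -> 'M[R[i]]_d)
    (rho : qop R n d) (i : {ffun 'I_n -> 'I_(d ^ 2 - 1)}) : R[i] :=
  \sum_x \sum_y rho x y * \prod_(j < n) lam (i j) (y j) (x j).

(* Squared modulus of a complex number (= z^2 for the real numbers z above). *)
Definition sqmod (R : realType) (z : R[i]) : R := complex.Re z ^+ 2 + complex.Im z ^+ 2.

(* ||tau(rho)|| : full-body correlation tensor norm. *)
Definition tau_norm (R : realType) (n d : nat) (lam : 'I_(d ^ 2 - 1) -> 'M[R[i]]_d)
    (rho : qop R n d) : R :=
  Num.sqrt (\sum_(i : {ffun 'I_n -> 'I_(d ^ 2 - 1)}) sqmod (corr lam rho i)).

(* Main.v *)
Require Import Defs.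
From HB Require Import structures.
From mathcomp Require Import all_boot all_order all_algebra.
From mathcomp Require Import complex.
From mathcomp Require Import reals.
From mathcomp Require Import ring lra zify.
Set Implicit Arguments. Unset Strict Implicit. Unset Printing Implicit Defensive.
Import Order.TTheory GRing.Theory Num.Theory.
Local Open Scope ring_scope.

(** For a pure state psi and a set A of parties write [purity psi A] for
    Tr rho_A^2, expressed as a swap test.  By completeness of the basis
    {1, lambda_l}, a sum of squared correlations in which each party is
    restricted to all generators, to the identity, or to the traceless ones
    is a signed sum of purities.  Let J contain one representative of each
    block.  Allowing the identity outside J only increases the sum, and on a
    product state the purity of a subset of J is the product of one-party
    purities, so the enlarged sum is the product over the n parties of
    d - [j in J] Tr rho_j^2.  Since Tr rho_j^2 >= 1/d, it is at most
    (d - 1/d)^k d^(n-k), which is the square of the claimed bound.  Mixed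
    states follow by convexity of the square. *)

Lemma sum_pairE (V : nmodType) (I J : finType) (F : I * J -> V) :
  \sum_p F p = \sum_i \sum_j F (i, j).
Proof. by rewrite pair_bigA; apply: eq_bigr => -[]. Qed.

(** * Splicing basis strings along a set of parties *)

Section Mix.
Variables (n d : nat).
Implicit Types (A B : {set 'I_n}) (x y z w : qidx n d).

Definition mix A x y : qidx n d := [ffun j => if j \in A then x j else y j].

Lemma mixK A x y : mix A (mix A x y) (mix A y x) = x.
Proof. by apply/ffunP=> j; rewrite !ffunE; case: (j \in A). Qed.

Lemma mix0 x y : mix set0 x y = y.
Proof. by apply/ffunP=> j; rewrite !ffunE inE. Qed.

Lemma mixC A x y : mix (~: A) x y = mix A y x.
Proof. by apply/ffunP=> j; rewrite !ffunE inE; case: (j \in A). Qed.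

Lemma sum_mix (V : nmodType) A (h : qidx n d -> qidx n d -> V) :
  \sum_x \sum_y h x y = \sum_x \sum_y h (mix A x y) (mix A y x).
Proof.
pose s (z : qidx n d * qidx n d) := (mix A z.1 z.2, mix A z.2 z.1).
have sK : cancel s s by case=> x y; rewrite /s /= !mixK.
by rewrite !pair_bigA /= (reindex_inj (can_inj sK)).
Qed.

(** One term of the expansion in [sum_pcorr]: on [A] the identity kernel ties [y] to [x] and [w] to
    [z], elsewhere the completeness kernel ties [y] to [w] and [x] to [z]. Together they determine
    [y] and [z] from [x] and [w]. *)
Lemma mix_indicator (K : comNzRingType) A x y z w :
  \prod_j (if j \in A then (y j == x j) && (w j == z j)
           else (y j == w j) && (x j == z j))%:R
  = ((y == mix A x w) && (z == mix A w x))%:R :> K.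
Proof.
rewrite -natr_prod; congr _%:R.
have [/andP[/eqP-> /eqP->]|ne] := boolP (_ && _).
  by apply: big1 => j _; rewrite !ffunE; case: (j \in A); rewrite !eqxx.
have [/forallP h|] := boolP [forall j, if j \in A then (y j == x j) && (w j == z j)
           else (y j == w j) && (x j == z j)].
  case/negP: ne; apply/andP; split; apply/eqP/ffunP => j; rewrite ffunE;
  by move: (h j); case: (j \in A) => /andP[/eqP ? /eqP ?].
rewrite negb_forall => /existsP[j /negbTE hj].
by rewrite (bigD1 j) //= hj mul0n.
Qed.

End Mix.

(** * Squared correlations as weighted sums of purities *)

Section CorrelationSums.
Variables (C : numClosedFieldType) (n d : nat) (L : finType) (M : L -> 'M[C]_d).
Variable psi : qidx n d -> C.

Definition pcorr (i : {ffun 'I_n -> L}) : C :=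
  \sum_x \sum_y psi x * (psi y)^* * \prod_(j < n) M (i j) (y j) (x j).

Definition purity (A : {set 'I_n}) : C :=
  \sum_x \sum_w psi x * (psi (mix A x w))^* * ((psi (mix A w x))^* * psi w).

(** A pure state has equal purities on both sides of a bipartition; here complementing [A] merely
    exchanges the two conjugated factors. *)
Lemma purityC A : purity (~: A) = purity A.
Proof.
by apply: eq_bigr => x _; apply: eq_bigr => w _; rewrite !mixC; ring.
Qed.

Lemma purity0 : \sum_x `|psi x| ^+ 2 = 1 -> purity set0 = 1.
Proof.
move=> h; rewrite -(mulr1 1) -{1}h -h big_distrlr /=.
apply: eq_bigr => x _; apply: eq_bigr => w _.
by rewrite !mix0 !normCK; ring.
Qed.

(** The hypothesis gives the summed kernel of each party: [f j] weighs the identity, [e j] the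
    completeness relation of a full operator basis. Each choice of one kernel per party contracts
    two copies of [psi] into a purity. *)
Lemma sum_pcorr (c : 'I_n -> pred L) (e f : 'I_n -> C) :
  (forall j a b a' b', \sum_(l | c j l) M l a b * (M l a' b')^* =
     f j * ((a == b) && (a' == b'))%:R + e j * ((a == a') && (b == b'))%:R) ->
  \sum_(i in family c) `|pcorr i| ^+ 2 =
  \sum_(A : {set 'I_n}) (\prod_j (if j \in A then f j else e j)) * purity A.
Proof.
move=> hK.
pose g i (p : qidx n d * qidx n d) :=
  psi p.1 * (psi p.2)^* * \prod_(j < n) M (i j) (p.2 j) (p.1 j).
pose co (p q : qidx n d * qidx n d) :=
  psi p.1 * (psi p.2)^* * ((psi q.1)^* * psi q.2).
transitivity (\sum_(i in family c) \sum_p \sum_q g i p * (g i q)^*).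
  apply: eq_bigr => i _; rewrite normCK /pcorr pair_bigA /= rmorph_sum /=.
  by rewrite big_distrlr.
rewrite exchange_big /=.
transitivity (\sum_p \sum_q \sum_(A : {set 'I_n})
   (\prod_j (if j \in A then f j else e j)) *
   (co p q * ((p.2 == mix A p.1 q.2) && (q.1 == mix A q.2 p.1))%:R)).
  apply: eq_bigr => p _; rewrite exchange_big /=; apply: eq_bigr => q _.
  transitivity (co p q * \sum_(i in family c)
      \prod_j (M (i j) (p.2 j) (p.1 j) * (M (i j) (q.2 j) (q.1 j))^*)).
    rewrite big_distrr /=; apply: eq_bigr => i _.
    rewrite /g !rmorphM /= rmorph_prod /= big_split /= conjCK /co; ring.
  rewrite -(bigA_distr_big_dep c (fun j l =>
     M l (p.2 j) (p.1 j) * (M l (q.2 j) (q.1 j))^*)) (eq_bigr _ (fun j _ => hK j _ _ _ _)).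
  (* [A] collects the parties that contribute their [f] term. *)
  rewrite bigA_distr big_distrr /=; apply: eq_bigr => A _.
  rewrite -mix_indicator mulrCA -big_split /=; congr (_ * _).
  by apply: eq_bigr => j _; case: ifP.
transitivity (\sum_p \sum_(A : {set 'I_n}) \sum_q
   (\prod_j (if j \in A then f j else e j)) *
   (co p q * ((p.2 == mix A p.1 q.2) && (q.1 == mix A q.2 p.1))%:R)).
  by apply: eq_bigr => p _; rewrite exchange_big.
rewrite exchange_big /=; apply: eq_bigr => A _.
set c0 := \prod_j _; rewrite sum_pairE.
rewrite /purity big_distrr /=; apply: eq_bigr => x _.
under eq_bigr => y _ do rewrite sum_pairE exchange_big /=.
rewrite exchange_big big_distrr /=; apply: eq_bigr => w _.
(* The indicator leaves a single pair [y], [z], which is the swap pattern of [purity]. *)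
rewrite (bigD1 (mix A x w)) //= (bigD1 (mix A w x)) //= !eqxx mulr1.
rewrite [X in _ + X]big1 ?addr0; last first.
  by move=> y /negbTE ny; apply: big1 => z _; rewrite ny /= !mulr0.
by rewrite big1 ?addr0 // => z /negbTE->; rewrite andbF !mulr0.
Qed.

End CorrelationSums.

Lemma eq_purity (C : numClosedFieldType) (n d : nat) (psi psi' : qidx n d -> C) :
  psi =1 psi' -> purity psi =1 purity psi'.
Proof.
by move=> h A; apply: eq_bigr => x _; apply: eq_bigr => y _; rewrite !h.
Qed.

(** * Purities of product states *)

Section Multiplicativity.
Variables (C : numClosedFieldType) (n d : nat).
Implicit Types (x y u v : qidx n d) (A B : {set 'I_n}).

(* Exchanging the coordinates in [B] between two independent copies of the
   system swaps the factors supported outside [B]. *)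
Lemma sum_swap_factors B (f f' g g' : qidx n d -> qidx n d -> C) :
  (forall x y u v, f (mix B x u) (mix B y v) = f x y) ->
  (forall x y u v, f' (mix B x u) (mix B y v) = f' x y) ->
  (forall x y u v, g (mix B x u) (mix B y v) = g u v) ->
  (forall x y u v, g' (mix B x u) (mix B y v) = g' u v) ->
  (\sum_x \sum_y f x y * g x y) * (\sum_x \sum_y f' x y * g' x y) =
  (\sum_x \sum_y f x y * g' x y) * (\sum_x \sum_y f' x y * g x y).
Proof.
have mulE (a b : qidx n d -> qidx n d -> C) :
  (\sum_x \sum_y a x y) * (\sum_u \sum_v b u v) =
  \sum_x \sum_u \sum_y \sum_v a x y * b u v.
  rewrite big_distrlr /=; apply: eq_bigr => x _; apply: eq_bigr => u _.
  by rewrite big_distrlr.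
move=> hf hf' hg hg'; rewrite !mulE (sum_mix B).
apply: eq_bigr => x _; apply: eq_bigr => u _; rewrite (sum_mix B).
apply: eq_bigr => y _; apply: eq_bigr => v _.
by rewrite hf hf' hg hg'; ring.
Qed.

(** The summand splits into a [phi] part, which sees the swapped set only inside [B], and a [chi]
    part, which sees it only outside. The factor [purity psi set0] accounts for normalization, as
    [phi] and [chi] need not be unit vectors. *)
Lemma purityM B A A' (phi chi : qidx n d -> C) :
  (forall x y, phi (mix B x y) = phi x) ->
  (forall x y, chi (mix B x y) = chi y) ->
  A \subset B -> A' \subset ~: B ->
  let psi := fun x => phi x * chi x in
  purity psi (A :|: A') * purity psi set0 = purity psi A * purity psi A'.
Proof.
move=> hphi hchi sA sA' psi.
pose t f (D : {set 'I_n}) x y : C :=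
  f x * (f (mix D x y))^* * ((f (mix D y x))^* * f y).
have pE D : purity psi D = \sum_x \sum_y t phi D x y * t chi D x y.
  apply: eq_bigr => x _; apply: eq_bigr => y _.
  by rewrite /psi /t !rmorphM; ring.
have mixmix D x y u v : mix D (mix B x u) (mix B y v) = mix B (mix D x y) (mix D u v).
  by apply/ffunP => j; rewrite !ffunE; case: (j \in D); case: (j \in B).
have tphi D x y u v : t phi D (mix B x u) (mix B y v) = t phi D x y.
  by rewrite /t !mixmix !hphi.
have tchi D x y u v : t chi D (mix B x u) (mix B y v) = t chi D u v.
  by rewrite /t !mixmix !hchi.
have notB j : j \in B -> j \notin A'.
  by move=> jB; apply/negP=> /(subsetP sA'); rewrite inE jB.
have phiU (D D' : {set 'I_n}) x y : (forall j, j \in B -> (j \in D) = (j \in D')) ->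
    t phi D x y = t phi D' x y.
  move=> h; suff m a b : phi (mix D a b) = phi (mix D' a b) by rewrite /t !m.
  rewrite -[LHS](hphi _ a) -[RHS](hphi _ a); congr phi; apply/ffunP=> j.
  by rewrite !ffunE; case: ifP => // /h->.
have chiU (D D' : {set 'I_n}) x y : (forall j, j \notin B -> (j \in D) = (j \in D')) ->
    t chi D x y = t chi D' x y.
  move=> h; suff m a b : chi (mix D a b) = chi (mix D' a b) by rewrite /t !m.
  rewrite -[LHS](hchi a) -[RHS](hchi a); congr chi; apply/ffunP=> j.
  by rewrite !ffunE; case: ifP => // /negbT/h->.
have notA j : j \notin B -> j \notin A by apply: contra => /(subsetP sA).
rewrite !pE.
(* The second factor supplies the [set0] parts, which are then exchanged between the two sums. *)
transitivity ((\sum_x \sum_y t phi A x y * t chi A' x y) *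
              (\sum_x \sum_y t phi set0 x y * t chi set0 x y)).
  congr (_ * _); apply: eq_bigr => x _; apply: eq_bigr => y _; congr (_ * _).
    by apply: phiU => j /notB/negbTE; rewrite inE orbC => ->.
  by apply: chiU => j /notA/negbTE; rewrite inE => ->.
rewrite (@sum_swap_factors B) //; congr (_ * _).
  apply: eq_bigr => x _; apply: eq_bigr => y _; congr (_ * _).
  by apply: chiU => j /notA/negbTE->; rewrite inE.
apply: eq_bigr => x _; apply: eq_bigr => y _; congr (_ * _).
by apply: phiU => j /notB/negbTE->; rewrite inE.
Qed.

(** Induction on the size of [A], splitting off the block of one [j] in [A]. Injectivity of [blk]
    keeps the rest of [A] outside that block, so [purityM] applies, with [purity psi set0] equal to
    1. *)
Lemma purity_transversal (k : nat) (blk : 'I_n -> 'I_k)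
    (phi : 'I_k -> qidx n d -> C) (psi : qidx n d -> C) A :
  \sum_x `|psi x| ^+ 2 = 1 ->
  (forall b x y, (forall j, blk j == b -> x j = y j) -> phi b x = phi b y) ->
  (forall x, psi x = \prod_(b < k) phi b x) ->
  {in A &, injective blk} ->
  purity psi A = \prod_(j in A) purity psi [set j].
Proof.
move=> psi1 dep psiE; have [m] := ubnP #|A|; elim: m A => // m IH A ltA inj.
have [->|[j jA]] := set_0Vmem A; first by rewrite big_set0 purity0.
pose B := [set i | blk i == blk j].
pose chi x := \prod_(b | b != blk j) phi b x.
have psiM x : psi x = phi (blk j) x * chi x by rewrite psiE (bigD1 (blk j)).
have hphi x y : phi (blk j) (mix B x y) = phi (blk j) x.
  by apply: dep => i ij; rewrite ffunE inE ij.
have hchi x y : chi (mix B x y) = chi y.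
  apply: eq_bigr => b bj; apply: dep => i /eqP ib.
  by rewrite ffunE inE ib (negbTE bj).
have sub1 : [set j] \subset B by rewrite sub1set inE.
have sub2 : A :\ j \subset ~: B.
  apply/subsetP => i; rewrite !inE => /andP[ij iA].
  by apply: contra ij => /eqP e; rewrite (inj _ _ iA jA e).
have := purityM hphi hchi sub1 sub2; rewrite /= -!(eq_purity psiM).
rewrite setD1K // (purity0 psi1) mulr1 => ->.
rewrite (IH (A :\ j)); last 2 first.
- by move: ltA; rewrite (cardsD1 j A) jA add1n ltnS.
- by move=> u v /setD1P[_ uA] /setD1P[_ vA]; apply: inj.
by rewrite [RHS](big_setD1 j).
Qed.

End Multiplicativity.

(** * Completeness of an orthogonal operator basis *)

Section Completeness.
Variables (C : numClosedFieldType) (d : nat) (L : finType) (M : L -> 'M[C]_d).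

(* The rows [M l], scaled, form a square unitary matrix, so orthonormality of
   the rows yields orthonormality of the columns. *)
Lemma completeness :
  (0 < d)%N -> #|L| = (d * d)%N ->
  (forall l l', \sum_a \sum_b M l a b * (M l' a b)^* = d%:R * (l == l')%:R) ->
  forall a b a' b', \sum_l M l a b * (M l a' b')^* =
     d%:R * ((a == a') && (b == b'))%:R.
Proof.
move=> d_gt0 cL orth a b a' b'.
have d0 : d%:R != 0 :> C by rewrite pnatr_eq0 -lt0n.
have e : #|{: 'I_d * 'I_d}| = #|L| by rewrite card_prod card_ord cL.
pose U : 'M[C]_#|{: 'I_d * 'I_d}| := \matrix_(i, j)
  M (enum_val (cast_ord e i)) (enum_val j).1 (enum_val j).2.
pose V : 'M[C]_#|{: 'I_d * 'I_d}| := \matrix_(j, i) (d%:R^-1 * (U i j)^*).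
have UV : U *m V = 1%:M.
  apply/matrixP => i i'; rewrite !mxE.
  have := orth (enum_val (cast_ord e i)) (enum_val (cast_ord e i')).
  rewrite (inj_eq enum_val_inj) (inj_eq (@cast_ord_inj _ _ e)) => h.
  apply: (mulfI d0); rewrite -h pair_bigA /= big_distrr /=.
  rewrite [RHS](reindex (enum_val : 'I_#|{: 'I_d * 'I_d}| -> _)) /=; last first.
    exact: (onW_bij _ (enum_val_bij _)).
  by apply: eq_bigr => j _; rewrite !mxE; field.
have /matrixP/(_ (enum_rank (a', b')) (enum_rank (a, b))) := mulmx1C UV.
rewrite !mxE (inj_eq enum_rank_inj) xpair_eqE => h.
rewrite [a == a']eq_sym [b == b']eq_sym -h big_distrr /=.
rewrite (reindex (fun i => enum_val (cast_ord e i))) /=; last first.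
  apply: onW_bij; apply: bij_comp; first exact: enum_val_bij.
  by exists (cast_ord (esym e)); [exact: cast_ordK|exact: cast_ordKV].
by apply: eq_bigr => i _; rewrite !mxE !enum_rankK /=; field.
Qed.

End Completeness.

(** * Correlation sums of a normalized pure state *)

Section PureStates.
Variables (C : numClosedFieldType) (n d : nat).
Variable lam : 'I_(d ^ 2 - 1) -> 'M[C]_d.
Hypotheses (d_gt0 : (0 < d)%N)
  (lam_herm : forall l a b, lam l a b = (lam l b a)^*)
  (lam_tr0 : forall l, \tr (lam l) = 0)
  (lam_orth : forall l l', \tr (lam l *m lam l') = d%:R * (l == l')%:R).

(** [None] plays the role of lambda_0, bringing the family to the [d * d] elements that
    [completeness] requires. *)
Definition with_id (l : option 'I_(d ^ 2 - 1)) : 'M[C]_d := oapp lam 1%:M l.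

Lemma with_id_complete a b a' b' :
  \sum_l with_id l a b * (with_id l a' b')^* =
  d%:R * ((a == a') && (b == b'))%:R.
Proof.
have herm l x y : (with_id l x y)^* = with_id l y x.
  case: l => [l|] /=; first by rewrite -lam_herm.
  by rewrite !mxE conjC_nat eq_sym.
apply: completeness => // [|l l'].
  by rewrite card_option card_ord mulnn subn1 prednK // expn_gt0 d_gt0.
transitivity (\tr (with_id l *m with_id l')).
  by apply: eq_bigr => x _; rewrite mxE; apply: eq_bigr => y _; rewrite herm.
case: l l' => [l|] [l'|] /=.
- by rewrite lam_orth.
- by rewrite mulmx1 lam_tr0 mulr0.
- by rewrite mul1mx lam_tr0 mulr0.
- by rewrite mul1mx mxtrace1 mulr1.
Qed.

Lemma with_id_None a b a' b' :
  with_id None a b * (with_id None a' b')^* = ((a == b) && (a' == b'))%:R.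
Proof. by rewrite /= !mxE conjC_nat -natrM mulnb. Qed.

Variable psi : qidx n d -> C.
Hypothesis psi1 : \sum_x `|psi x| ^+ 2 = 1.

Lemma pcorr_None : pcorr with_id psi [ffun=> None] = 1.
Proof.
rewrite -psi1; apply: eq_bigr => x _.
rewrite (bigD1 x) //= [X in _ + X]big1 ?addr0 => [|y yx].
  by rewrite big1 ?mulr1 ?normCK // => j _; rewrite ffunE /= mxE eqxx.
have [j yj] : exists j, y j != x j.
  apply/existsP; apply: contraR yx; rewrite negb_exists => /forallP h.
  by apply/eqP/ffunP=> j; apply/eqP; move: (h j); rewrite negbK.
by rewrite (bigD1 j) //= ffunE /= mxE (negbTE yj) mul0r mulr0.
Qed.

(* Keeping only the correlations supported on party [j], the identity term
   alone contributes [1]; the total is [d] times the purity of [~: [set j]]. *)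
Lemma purity1_ge j : d%:R^-1 <= purity psi [set j].
Proof.
pose c (i : 'I_n) : pred (option 'I_(d ^ 2 - 1)) := [pred l | (i == j) || (l == None)].
have K i a b a' b' : \sum_(l | c i l) with_id l a b * (with_id l a' b')^* =
    (i != j)%:R * ((a == b) && (a' == b'))%:R +
    d%:R * (i == j)%:R * ((a == a') && (b == b'))%:R.
  have [->|ij] /= := eqVneq i j.
    rewrite (eq_bigl predT) => [|l]; last by rewrite /c /= eqxx.
    by rewrite with_id_complete mul0r add0r mulr1.
  rewrite (eq_bigl (pred1 None)) => [|l]; last by rewrite /c /= (negbTE ij).
  by rewrite big_pred1_eq with_id_None mul1r mulr0 mul0r addr0.
have := sum_pcorr psi K.
rewrite [RHS](bigD1 (~: [set j])) //= [X in _ + X]big1 ?addr0 => [|A nA]; last first.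
  (* The [f] weight vanishes at [j] and the [e] weight everywhere else, so any set other than [~:
     [set j]] has a zero factor. *)
  have [i hi] : exists i, (i \in A) == (i == j).
    apply/existsP; apply: contraR nA; rewrite negb_exists => /forallP h.
    by apply/eqP/setP=> i; rewrite !inE; move: (h i); case: (i \in A); case: (i == j).
  rewrite (bigD1 i) //= (eqP hi).
  by case: eqP => _ /=; rewrite ?mulr0 ?mul0r.
rewrite (bigD1 j) //= !inE eqxx /= mulr1.
rewrite [X in _ * X * _]big1 ?mulr1 => [|i ij]; last by rewrite !inE ij.
rewrite purityC => h; rewrite -[X in X <= _]mulr1 ler_pdivrMl ?ltr0n // -h.
rewrite (bigD1 [ffun=> None]) /=; last first.
  by apply/familyP => i; rewrite ffunE inE eqxx orbT.
rewrite pcorr_None normr1 expr1n lerDl; apply: sumr_ge0 => i _.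
by rewrite exprn_ge0.
Qed.

(** Excluding the identity on [J] subtracts its kernel from the completeness relation: [e] is [d],
    and [f] is -1 on [J] and 0 elsewhere. Only subsets of [J] survive, and since their purities
    factor, the signed sum folds back into a product. *)
Lemma sum_pcorr_transversal (J : {set 'I_n}) :
  (forall A : {set 'I_n}, A \subset J ->
     purity psi A = \prod_(j in A) purity psi [set j]) ->
  \sum_(i in family (fun j => [pred l | (j \in J) ==> (l != None)]))
     `|pcorr with_id psi i| ^+ 2 =
  \prod_j (d%:R - (j \in J)%:R * purity psi [set j]).
Proof.
move=> hJ.
rewrite (@sum_pcorr C n d _ with_id psi _ (fun=> d%:R) (fun j => - (j \in J)%:R)).
  under [RHS]eq_bigr => j _ do rewrite addrC -mulNr.
  rewrite bigA_distr; apply: eq_bigr => A _.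
  have [sAJ|/subsetPn[j jA jJ]] := boolP (A \subset J); last first.
    by rewrite (bigD1 j) //= [RHS](bigD1 j) //= jA (negbTE jJ) oppr0 !mul0r.
  rewrite hJ // [X in _ * X]big_mkcond -big_split /=.
  by apply: eq_bigr => j _; case: ifP; rewrite ?mulr1.
move=> j a b a' b' /=; rewrite -with_id_complete -with_id_None.
case: (j \in J) => /=; last by rewrite oppr0 mul0r add0r.
by rewrite [X in _ + X](bigD1 None) //= mulN1r addKr.
Qed.

(** For [J] equal to [[set j]], a sum of squares equals d - Tr rho_j^2 times a positive number. This
    crude bound suffices to make the factors in [sum_full_corr_le] nonnegative. *)
Lemma purity1_le j : purity psi [set j] <= d%:R.
Proof.
have h (A : {set 'I_n}) : A \subset [set j] ->
     purity psi A = \prod_(j in A) purity psi [set j].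
  by rewrite subset1 => /orP[]/eqP->; rewrite ?big_set1 // big_set0 purity0.
have := sum_pcorr_transversal h; rewrite (bigD1 j) //= inE eqxx mul1r.
under [X in _ = _ * X]eq_bigr => i ij do rewrite inE (negbTE ij) mul0r subr0.
move=> e; rewrite -subr_ge0.
have : 0 <= (d%:R - purity psi [set j]) * \prod_(i < n | i != j) (d%:R : C).
  by rewrite -e; apply: sumr_ge0 => i _; rewrite exprn_ge0.
by rewrite pmulr_lge0 // prodr_gt0 // => i _; rewrite ltr0n.
Qed.

Lemma sum_full_corr_le (J : {set 'I_n}) :
  (forall A : {set 'I_n}, A \subset J ->
     purity psi A = \prod_(j in A) purity psi [set j]) ->
  \sum_i `|pcorr lam psi i| ^+ 2 <=
  \prod_j (d%:R - (j \in J)%:R / d%:R).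
Proof.
move=> hJ.
(* Factorwise comparison: [purity1_ge] bounds each factor from above, and [purity1_le] gives the
   nonnegativity that [ler_prod] demands. *)
apply: (@le_trans _ _ (\prod_j (d%:R - (j \in J)%:R * purity psi [set j]))); last first.
  apply: ler_prod => j _; case: (j \in J); last by rewrite !mul0r subr0 ler0n lexx.
  by rewrite !mul1r subr_ge0 purity1_le lerB // purity1_ge.
rewrite -(sum_pcorr_transversal hJ).
(* Full correlations embed into the enlarged family through [h]; the terms outside its image are
   squares. *)
pose h (i : {ffun 'I_n -> 'I_(d ^ 2 - 1)}) : {ffun 'I_n -> option _} :=
  [ffun j => Some (i j)].
have hinj : injective h.
  by move=> i i' /ffunP e; apply/ffunP => j; have := e j; rewrite !ffunE => -[].
have -> : \sum_i `|pcorr lam psi i| ^+ 2 =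
    \sum_(i in h @: setT) `|pcorr with_id psi i| ^+ 2.
  rewrite big_imset /=; last by move=> ? ? _ _; apply: hinj.
  apply: eq_big => [i|i _]; first by rewrite inE.
  congr (`|_| ^+ 2); apply: eq_bigr => x _; apply: eq_bigr => y _; congr (_ * _).
  by apply: eq_bigr => j _; rewrite ffunE.
rewrite big_mkcond [X in _ <= X]big_mkcond /=; apply: ler_sum => i _.
case: ifP => [/imsetP[i' _ ->]|_].
  suff -> : h i' \in family (fun j => [pred l | (j \in J) ==> (l != None)]) by [].
  by apply/familyP => j; rewrite ffunE inE implybT.
by case: ifP => // _; rewrite exprn_ge0.
Qed.

End PureStates.

(** * Convexity of the squared modulus *)

Lemma sqr_mean_le (F : realFieldType) (m : nat) (p a : 'I_m -> F) :
  (forall l, 0 <= p l) -> \sum_l p l = 1 ->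
  (\sum_l p l * a l) ^+ 2 <= \sum_l p l * a l ^+ 2.
Proof.
move=> p0 p1; set s := \sum_l p l * a l.
(* The claim is nonnegativity of the variance. *)
have : 0 <= \sum_l p l * (a l - s) ^+ 2.
  by apply: sumr_ge0 => l _; rewrite mulr_ge0 ?sqr_ge0.
have -> : \sum_l p l * (a l - s) ^+ 2 =
    \sum_l (p l * a l ^+ 2 + (- (2 * s) * (p l * a l) + s ^+ 2 * p l)).
  by apply: eq_bigr => l _; ring.
rewrite !big_split /= -!mulr_sumr p1 -/s => h.
by rewrite -subr_ge0; apply: le_trans h _; lra.
Qed.

Lemma sqmod_mean_le (R : realType) (m : nat) (p : 'I_m -> R) (z : 'I_m -> R[i]) :
  (forall l, 0 <= p l) -> \sum_l p l = 1 ->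
  sqmod (\sum_l (p l)%:C%C * z l) <= \sum_l p l * sqmod (z l).
Proof.
move=> p0 p1.
have ReE : complex.Re (\sum_l (p l)%:C%C * z l) = \sum_l p l * complex.Re (z l).
  rewrite raddf_sum; apply: eq_bigr => l _.
  by case: (z l) => a b /=; rewrite mul0r subr0.
have ImE : complex.Im (\sum_l (p l)%:C%C * z l) = \sum_l p l * complex.Im (z l).
  rewrite raddf_sum; apply: eq_bigr => l _.
  by case: (z l) => a b /=; rewrite mul0r addr0.
rewrite /sqmod ReE ImE.
under [X in _ <= X]eq_bigr => l _ do rewrite mulrDr.
by rewrite big_split lerD // sqr_mean_le.
Qed.

(** * The bound for pure states and its closed form *)

Lemma sqmodE (R : realType) (z : R[i]) : (sqmod z)%:C%C = `|z| ^+ 2.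
Proof.
by rewrite normc_def -rmorphXn /= sqr_sqrtr // addr_ge0 ?sqr_ge0.
Qed.

Lemma kseparable_pure_bound (R : realType) (n d k : nat)
    (lam : 'I_(d ^ 2 - 1) -> 'M[R[i]]_d) (psi : qidx n d -> R[i]) :
  (0 < d)%N -> su_generators lam -> kseparable_pure k psi ->
  \sum_i sqmod (pcorr lam psi i) <=
  (d%:R - d%:R^-1) ^+ k * d%:R ^+ (n - k) :> R.
Proof.
move=> d_gt0 [herm [tr0 orth]] [psi1 [blk [blk_onto [phi [dep psiE]]]]].
(* Blocks are nonempty, so each has a representative; these form the transversal [J]. *)
have [rep repK] := fin_all_exists blk_onto.
pose J := [set rep b | b in 'I_k].
have cJ : #|J| = k by rewrite card_imset ?card_ord //; exact: can_inj repK.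
have injJ : {in J &, injective blk}.
  by move=> _ _ /imsetP[b _ ->] /imsetP[b' _ ->]; rewrite !repK => ->.
have hJ (A : {set 'I_n}) : A \subset J ->
    purity psi A = \prod_(j in A) purity psi [set j].
  move=> /subsetP sAJ; apply: (purity_transversal psi1 dep psiE).
  by move=> u v /sAJ uJ /sAJ vJ; apply: injJ.
rewrite -lecR rmorph_sum /=; under eq_bigr => i _ do rewrite sqmodE.
apply: le_trans (sum_full_corr_le d_gt0 herm tr0 orth psi1 hJ) _.
(* What remains is an equality: [k] factors d - 1/d over [J] and n - k factors d elsewhere. *)
rewrite le_eqVlt; apply/orP; left; apply/eqP.
rewrite (bigID (mem J)) /=.
rewrite (eq_bigr (fun=> d%:R - d%:R^-1)) => [|j ->]; last by rewrite mul1r.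
rewrite [X in _ * X](eq_bigr (fun=> d%:R)) => [|j /negbTE->]; last first.
  by rewrite mul0r subr0.
rewrite !prodr_const cJ.
have -> : #|[pred j | j \notin J]| = (n - k)%N.
  by rewrite -cJ -[n in (n - _)%N]card_ord -(cardC J) addKn.
by rewrite rmorphM !rmorphXn rmorphB /= fmorphV !rmorph_nat.
Qed.

(** In a balanced partition, [r] blocks of size [c] and [k - r] of size [q] add up to [n]. The
    powers of [x] thus collect to x^(n - 2k), of which x^(-k) turns (x^2 - 1)^k into (x - 1/x)^k. *)
Lemma bound_exponents (F : fieldType) (x : F) (n k : nat) :
  x != 0 -> (0 < k)%N -> (k <= n)%N ->
  (x ^+ 2 - 1) ^+ k * (x ^ (((n + k - 1) %/ k)%N%:Z - 2)) ^+ (n - k * (n %/ k))%N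
    * (x ^ ((n %/ k)%N%:Z - 2)) ^+ (k - (n - k * (n %/ k)))%N
  = (x - x^-1) ^+ k * x ^+ (n - k).
Proof.
move=> x0 k0 kn.
have expB (a : nat) : x ^ (a%:Z - 2) = x ^+ a * x ^- 2 by rewrite expfzDr.
rewrite !expB; set c := (_ %/ _)%N; set q := (n %/ k)%N; set r := (n - k * q)%N.
have rk : (r < k)%N by rewrite /r /q; move: (divn_eq n k) (ltn_pmod n k0); lia.
have E : (c * r + q * (k - r) = n)%N.
  (* For [r = 0] the term with [c] vanishes. Otherwise n + k - 1 = (q + 1) k + (r - 1) with r - 1 <
     k, so [c] is [q.+1]. *)
  have [r0|r0] := posnP r.
    by move: r0 (leq_trunc_div n k); rewrite -/q /r; nia.
  have -> : c = q.+1.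
    rewrite /c (_ : (n + k - 1 = q.+1 * k + r.-1)%N); last first.
      by move: r0 (leq_trunc_div n k); rewrite -/q /r; nia.
    by rewrite divnMDl // divn_small ?addn0 //; lia.
  by move: (leq_trunc_div n k); rewrite -/q /r; nia.
rewrite -mulrA !exprMn mulrACA -!exprM -exprD E -exprD subnKC 1?ltnW //.
have -> : x - x^-1 = (x ^+ 2 - 1) / x by field.
have -> : x ^+ n = x ^+ k * x ^+ (n - k) by rewrite -exprD subnKC.
rewrite exprMn -!mulrA; congr (_ * _).
rewrite [x ^+ (n - k) * _]mulrC mulrA -exprMn; congr (_ ^+ _ * _).
by field.
Qed.

Theorem theorem1 (R : realType) (n d k : nat) (lam : 'I_(d ^ 2 - 1) -> 'M[R[i]]_d)
    (rho : qop R n d) :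
  (1 <= n)%N -> (2 <= d)%N -> (1 <= k)%N -> (k <= n)%N ->
  su_generators lam ->
  kseparable k rho ->
  tau_norm lam rho <=
    Num.sqrt ((d%:R ^+ 2 - 1) ^+ k
              * ((d%:R : R) ^ ((((n + k - 1) %/ k)%N)%:Z - 2)) ^+ (n - k * (n %/ k))%N
              * ((d%:R : R) ^ (((n %/ k)%N)%:Z - 2)) ^+ (k - (n - k * (n %/ k)))%N).
Proof.
move=> _ d2 k0 kn su [m [p [psi [p0 [p1 [sep rhoE]]]]]].
have d_gt0 : (0 < d)%N by exact: ltnW.
rewrite bound_exponents // ?pnatr_eq0 -?lt0n //; apply: ler_wsqrtr.
have corrE i : corr lam rho i = \sum_l (p l)%:C%C * pcorr lam (psi l) i.
  under [RHS]eq_bigr => l _ do rewrite mulr_sumr.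
  rewrite exchange_big; apply: eq_bigr => x _ /=.
  under [RHS]eq_bigr => l _ do rewrite mulr_sumr.
  rewrite exchange_big; apply: eq_bigr => y _ /=.
  by rewrite rhoE mulr_suml; apply: eq_bigr => l _; rewrite !mulrA.
(* Correlations are linear in the state, so convexity applies index by index; the pure bound is then
   averaged with the weights [p], whose sum is 1. *)
apply: (@le_trans _ _ (\sum_i \sum_l p l * sqmod (pcorr lam (psi l) i))).
  by apply: ler_sum => i _; rewrite corrE sqmod_mean_le.
rewrite exchange_big /=; set b := (X in _ <= X).
rewrite -[b]mul1r -p1 mulr_suml; apply: ler_sum => l _.
by rewrite -mulr_sumr ler_wpM2l //; apply: kseparable_pure_bound.
Qed.
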